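(* Let $I$ be a closed ideal in a C*-ternary ring $M$. Then $\widehat{\mathcal A}(I)$ is a closed self-adjoint (two-sided) ideal in $\mathcal A(M)$. The map $I\mapsto\widehat{\mathcal A}(I)$ is injective from closed ideals of $M$ to closed self-adjoint two-sided ideals of $\mathcal A(M)$.
   Context: An associative triple system (of the second kind) is a complex vector space $M$ with a map $(x,y,z)\mapsto[xyz]$, $M^3\to M$, linear in $x$ and $z$, conjugate-linear in $y$, with $[[xyz]uv]=[x[uzy]v]=[xy[zuv]]$. A C*-ternary ring is an associative triple system that is also a complex Banach space with $\|[xyz]\|\le\|x\|\|y\|\|z\|$ and $\|[xxx]\|=\|x\|^3$. An ideal of $M$ is a linear subspace $I$ with $[MMI]\subset I$, $[IMM]\subset I$ and $[MIM]\subset I$. Normed standard embedding. For $g,h\in M$ put $\ell_M(g,h)=\ell(g,h)=([gh\,\cdot],[hg\,\cdot])$ and $r_M(g,h)=r(g,h)=([\,\cdot\, gh],[\,\cdot\, hg])$, pairs of operators on $M$. On pairs $A=(A_1,A_2)$ scalars act by $\lambda(A_1,A_2)=(\lambda A_1,\overline\lambda A_2)$, and $\overline{(A_1,A_2)}=(A_2,A_1)$. Let $L_0(M)=\operatorname{span}\{\ell(g,h)\}$ with product $AA'=(A_1A_1',A_2'A_2)$ and $R_0(M)=\operatorname{span}\{r(g,h)\}$ with product $B\circ B'=(B_1'B_1,B_2B_2')$. Let $L(M)$, $R(M)$ be the closures of $L_0(M)$, $R_0(M)$ in $B(M\oplus M)$, the pair $(A_1,A_2)$ acting diagonally ($M\oplus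 M$ with the max norm). Let $\overline M=\{\overline f:f\in M\}$ be the conjugate space of $M$ ($\lambda\overline f=\overline{\overline\lambda f}$). Actions: $A\cdot f=A_1f$, $f\cdot B=B_1f$, $B\cdot\overline f=\overline{B_2f}$, $\overline f\cdot A=\overline{A_2f}$. $\mathcal A(M)$ is the space of matrices $\begin{bmatrix}A&f\\ \overline g&B\end{bmatrix}$ with $A\in L(M)$, $f,g\in M$, $B\in R(M)$, with product $$\begin{bmatrix}A&f\\ \overline g&B\end{bmatrix}\begin{bmatrix}A'&f'\\ \overline{g'}&B'\end{bmatrix}=\begin{bmatrix}AA'+\ell(f,g')&A\cdot f'+f\cdot B'\\ \overline g\cdot A'+B\cdot\overline{g'}&r(g,f')+B\circ B'\end{bmatrix}$$ and involution $\begin{bmatrix}A&f\\ \overline g&B\end{bmatrix}^\#=\begin{bmatrix}\overline A&g\\ \overline f&\overline B\end{bmatrix}$. It is a Banach algebra in a norm equivalent to $\max(\|A\|,\|f\|,\|g\|,\|B\|)$. For a closed ideal $I$ of $M$, $\widehat L(I)=\overline{\operatorname{span}}\{\ell_M(f,g):f,g\in I\}\subset L(M)$, $\widehat R(I)=\overline{\operatorname{span}}\{r_M(f,g):f,g\in I\}\subset R(M)$ (closures in $B(M\oplus M)$), and $$\widehat{\mathcal A}(I)=\begin{bmatrix}\widehat L(I)&I\\ \overline I&\widehat R(I)\end{bmatrix}\subset\mathcal A(M).$$ *)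

(* Defs.v *)
From HB Require Import structures.
From mathcomp Require Import all_boot all_order all_algebra.
From mathcomp Require Import complex.
From mathcomp Require Import all_classical all_reals.
From mathcomp Require Import topology normedtype.

Set Implicit Arguments.
Unset Strict Implicit.
Unset Printing Implicit Defensive.

Import Order.TTheory GRing.Theory Num.Theory.
Import numFieldNormedType.Exports.

Local Open Scope classical_set_scope.
Local Open Scope ring_scope.

HB.mixin Record isAssocTripleSystem (R : realType) M & GRing.Lmodule R[i] M := {
  tri : M -> M -> M -> M;
  tri_linear1 : forall (a : R[i]) x x' y z,
    tri (a *: x + x') y z = a *: tri x y z + tri x' y z;
  tri_conjlinear2 : forall (a : R[i]) x y y' z,
    tri x (a *: y + y') z = a^* *: tri x y z + tri x y' z;
  tri_linear3 : forall (a : R[i]) x y z z',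
    tri x y (a *: z + z') = a *: tri x y z + tri x y z';
  tri_assoc_mid : forall x y z u v,
    tri (tri x y z) u v = tri x (tri u z y) v;
  tri_assoc_right : forall x y z u v,
    tri (tri x y z) u v = tri x y (tri z u v)
}.

#[short(type="assocTripleSystemType")]
HB.structure Definition AssocTripleSystem (R : realType) :=
  {M of GRing.Lmodule R[i] M & isAssocTripleSystem R M}.

HB.mixin Record isCstarTernaryRing (R : realType) M
    & CompleteNormedModule R[i] M & AssocTripleSystem R M := {
  tri_norm_le : forall x y z : M, `|tri x y z| <= `|x| * `|y| * `|z|;
  tri_norm_cube : forall x : M, `|tri x x x| = `|x| ^+ 3
}.

#[short(type="cstarTernaryRingType")]
HB.structure Definition CstarTernaryRing (R : realType) :=
  {M of CompleteNormedModule R[i] M & AssocTripleSystem R M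
      & isCstarTernaryRing R M}.


Section BoundedOperators.
Variables (R : realType) (V : normedModType R[i]).

Definition bounded_linear (f : V -> V) : Prop :=
  linear f /\ exists k : R[i], forall x, `|f x| <= k * `|x|.

Definition bounded_linear_pred : {pred V -> V} := fun f => `[< bounded_linear f >].

Lemma bounded_linear_submod : GRing.submod_closed bounded_linear_pred.
Proof.
split.
  apply/asboolP; split; first by move=> a x y; rewrite /= scaler0 addr0.
  by exists 0 => x; rewrite normr0 mul0r.
move=> a f g /asboolP[flin [k kf]] /asboolP[glin [l lg]].
apply/asboolP; split.
  move=> b x y.
  change (a *: f (b *: x + y) + g (b *: x + y) =
          b *: (a *: f x + g x) + (a *: f y + g y)).
  by rewrite flin glin !scalerDr !scalerA [a * b]mulrC addrACA.
exists (`|a| * k + l) => x.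
change (`|a *: f x + g x| <= (`|a| * k + l) * `|x|).
rewrite (le_trans (ler_normD _ _))// mulrDl lerD// normrZ -mulrA.
exact: ler_wpM2l.
Qed.

HB.instance Definition _ :=
  GRing.isSubmodClosed.Build R[i] (V -> V) bounded_linear_pred bounded_linear_submod.

Record bop := Bop { bop_fun :> V -> V; bop_subproof : bop_fun \in bounded_linear_pred }.

HB.instance Definition _ := [isSub for bop_fun].
HB.instance Definition _ := [Choice of bop by <:].
HB.instance Definition _ := [SubChoice_isSubLmodule of bop by <:].

Lemma bopE (f g : bop) : f =1 g -> f = g.
Proof. by move=> fg; apply/val_inj/funext. Qed.

Lemma bop_bounded_linear (f : bop) : bounded_linear f.
Proof. exact: asboolW (bop_subproof f). Qed.

Definition mkbop (f : V -> V) (fP : bounded_linear f) : bop := Bop (asboolT fP).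

Lemma bop_linear (f : bop) : linear f.
Proof. by have [] := bop_bounded_linear f. Qed.

HB.instance Definition _ (f : bop) :=
  GRing.isLinear.Build R[i] V V *:%R f (bop_linear f).

Lemma bounded_linear_comp (f g : bop) : bounded_linear (f \o g).
Proof.
have [flin [k kf]] := bop_bounded_linear f.
have [glin [l lg]] := bop_bounded_linear g.
split=> [a x y /=|]; first by rewrite !linearP.
exists (`|k| * l) => x /=; rewrite -mulrA (le_trans (kf _))//.
have [->|gx0] := eqVneq `|g x| 0.
  by rewrite mulr0 mulr_ge0// (le_trans _ (lg x)).
apply: (@le_trans _ _ (`|k| * `|g x|)); last exact: ler_wpM2l.
rewrite ler_wpM2r// real_ler_norm//.
have gx : 0 < `|g x| by rewrite lt_def gx0 normr_ge0.
by rewrite ger0_real// -(pmulr_lge0 _ gx) (le_trans _ (kf _)).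
Qed.

Definition bcomp (f g : bop) : bop := mkbop (bounded_linear_comp f g).

(* The norm of a normed space over R[i] takes its values in R[i] (in the
   nonnegative reals), hence the projection to R and the cast back. *)
Definition opnorm (f : bop) : R[i] :=
  (sup [set complex.Re `|f x| | x in [set x : V | (`|x| <= 1)%R]])%:C%C.

End BoundedOperators.

Section OperatorNorm.
Variables (R : realType) (V : normedModType R[i]).
Implicit Types (f g : bop V) (x : V).

Lemma Re_normK x : (complex.Re `|x|)%:C%C = `|x|.
Proof. exact/RRe_real/normr_real. Qed.

Lemma bop_bound f : exists2 k : R, 0 <= k & forall x, `|f x| <= k%:C%C * `|x|.
Proof.
have [_ [k kf]] := bop_bounded_linear f.
have kE : (complex.Re `|k|)%:C%C = `|k| by exact/RRe_real/normr_real.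
exists (complex.Re `|k|); first by rewrite -ler0c kE.
move=> x; rewrite kE (le_trans (kf x))//.
have [->|x0] := eqVneq `|x| 0; first by rewrite !mulr0.
have {}x0 : 0 < `|x| by rewrite lt_def x0 normr_ge0.
rewrite ler_wpM2r// real_ler_norm//.
by rewrite ger0_real// -(pmulr_lge0 _ x0) (le_trans _ (kf x)).
Qed.

Let unit_image f := [set complex.Re `|f x| | x in [set x : V | (`|x| <= 1)%R]].

Let unit_image_nonempty f : unit_image f !=set0.
Proof. by exists (complex.Re `|f 0|), 0 => //=; rewrite normr0. Qed.

Lemma opnorm_le f (k : R[i]) :
  0 <= k -> (forall x, `|f x| <= k * `|x|) -> opnorm f <= k.
Proof.
move=> k0 kf; rewrite -(RRe_real (ger0_real k0)) lecR.
apply: ge_sup; first exact: unit_image_nonempty.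
move=> _ [x /= x1 <-]; rewrite -lecR Re_normK (RRe_real (ger0_real k0)) (le_trans (kf x))//.
by rewrite ler_piMr.
Qed.

Lemma opnorm_ge0 f : 0 <= opnorm f.
Proof.
rewrite ler0c; have [k k0 kf] := bop_bound f.
apply: (@le_trans _ _ (complex.Re `|f 0|)).
  by rewrite -ler0c Re_normK.
apply: ub_le_sup; last by exists 0 => //=; rewrite normr0.
exists k => _ [x /= x1 <-]; rewrite -lecR Re_normK (le_trans (kf x))//.
by rewrite ler_piMr// ler0c.
Qed.

Lemma opnormP f x : `|f x| <= opnorm f * `|x|.
Proof.
have [->|x0] := eqVneq x 0; first by rewrite linear0 !normr0 mulr0.
have {}x0 : 0 < `|x| by rewrite normr_gt0.
rewrite -ler_pdivrMr// mulrC.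
have -> : `|x|^-1 * `|f x| = `|f (`|x|^-1 *: x)|.
  by rewrite linearZ normrZ ger0_norm// invr_ge0.
rewrite -Re_normK lecR; apply: ub_le_sup; last first.
  exists (`|x|^-1 *: x) => //=.
  by rewrite normrZ ger0_norm ?invr_ge0// mulVf ?gt_eqF.
have [k k0 kf] := bop_bound f.
exists k => _ [y /= y1 <-]; rewrite -lecR Re_normK (le_trans (kf y))//.
by rewrite ler_piMr// ler0c.
Qed.

Lemma opnormD f g : opnorm (f + g) <= opnorm f + opnorm g.
Proof.
apply: opnorm_le => [|x]; first by rewrite addr_ge0// opnorm_ge0.
change (`|f x + g x| <= (opnorm f + opnorm g) * `|x|).
by rewrite (le_trans (ler_normD _ _))// mulrDl lerD// opnormP.
Qed.

Lemma opnorm_scale f g (a : R[i]) :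
  (forall x, `|g x| = `|a| * `|f x|) -> opnorm g = `|a| * opnorm f.
Proof.
move=> gf; apply/le_anti/andP; split.
  apply: opnorm_le => [|x]; first by rewrite mulr_ge0// opnorm_ge0.
  by rewrite gf -mulrA ler_wpM2l// opnormP.
have [a0|a0] := eqVneq a 0; first by rewrite a0 normr0 mul0r opnorm_ge0.
rewrite -ler_pdivlMl ?normr_gt0//; apply: opnorm_le => [|x].
  by rewrite mulr_ge0 ?invr_ge0// opnorm_ge0.
by rewrite -mulrA ler_pdivlMl ?normr_gt0// -gf opnormP.
Qed.

Lemma opnormZ (a : R[i]) f : opnorm (a *: f) = `|a| * opnorm f.
Proof. by apply: opnorm_scale => x; rewrite -normrZ. Qed.

Lemma opnorm0_eq0 f : opnorm f = 0 -> f = 0.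
Proof.
move=> f0; apply: bopE => x; apply/eqP; rewrite -normr_le0.
by rewrite (le_trans (opnormP f x))// f0 mul0r.
Qed.

HB.instance Definition _ :=
  Lmodule_isNormed.Build R[i] (bop V) opnormD opnormZ opnorm0_eq0.

Lemma bop_normE f : `|f| = opnorm f. Proof. by []. Qed.

End OperatorNorm.

Section ConjugateSpace.
Variables (R : realType) (V : normedModType R[i]).

(* The same additive group and the same norm, with the conjugate scalar action. *)
Definition conj_space : Type := V.
Definition bar (f : V) : conj_space := f.
Definition unbar (f : conj_space) : V := f.

HB.instance Definition _ := PseudoMetricNormedZmod.copy conj_space V.

Let conj_scale (a : R[i]) (f : conj_space) : conj_space := bar (a^* *: unbar f).

Let conj_scaleA a b f : conj_scale a (conj_scale b f) = conj_scale (a * b) f.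
Proof. by rewrite /conj_scale scalerA rmorphM. Qed.

Let conj_scale1 : left_id 1 conj_scale.
Proof. by move=> f; rewrite /conj_scale rmorph1 scale1r. Qed.

Let conj_scaleDr : right_distributive conj_scale +%R.
Proof. by move=> a f g; rewrite /conj_scale -scalerDr. Qed.

Let conj_scaleDl f : {morph conj_scale^~ f : a b / a + b}.
Proof. by move=> a b; rewrite /conj_scale rmorphD /= scalerDl. Qed.

HB.instance Definition _ := GRing.Zmodule_isLmodule.Build R[i] conj_space
  conj_scaleA conj_scale1 conj_scaleDr conj_scaleDl.

Let conj_normrZ (a : R[i]) (f : conj_space) : `|a *: f| = `|a| * `|f|.
Proof. by rewrite -norm_conjC -[LHS]/(`|a^* *: unbar f|) normrZ. Qed.

HB.instance Definition _ :=
  PseudoMetricNormedZmod_Lmodule_isNormedModule.Build R[i] conj_space conj_normrZ.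

Lemma bar_scale (a : R[i]) (f : V) : a *: bar f = bar (a^* *: f).
Proof. by []. Qed.

End ConjugateSpace.

Section OperatorPairs.
Variables (R : realType) (V : normedModType R[i]).

Definition opair : Type := (bop V * bop V)%type.

HB.instance Definition _ := GRing.Zmodule.copy opair (bop V * bop V)%type.

Let opair_scale (a : R[i]) (A : opair) : opair := (a *: A.1, a^* *: A.2).

Let opair_scaleA a b A : opair_scale a (opair_scale b A) = opair_scale (a * b) A.
Proof. by rewrite /opair_scale /= !scalerA rmorphM. Qed.

Let opair_scale1 : left_id 1 opair_scale.
Proof. by case=> A1 A2; rewrite /opair_scale rmorph1 !scale1r. Qed.

Let opair_scaleDr : right_distributive opair_scale +%R.
Proof. by move=> a A B; rewrite /opair_scale !scalerDr. Qed.

Let opair_scaleDl A : {morph opair_scale^~ A : a b / a + b}.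
Proof. by move=> a b; rewrite /opair_scale rmorphD !scalerDl. Qed.

HB.instance Definition _ := GRing.Zmodule_isLmodule.Build R[i] opair
  opair_scaleA opair_scale1 opair_scaleDr opair_scaleDl.

Lemma opair_scaleE (a : R[i]) (A : opair) : a *: A = (a *: A.1, a^* *: A.2).
Proof. by []. Qed.

Lemma bounded_linear_diag (A : opair) :
  @bounded_linear R (V * V)%type (fun x => (A.1 x.1, A.2 x.2)).
Proof.
split=> [a x y|]; first by rewrite /= !linearP.
exists (opnorm A.1 + opnorm A.2) => -[x y].
rewrite !prod_normE /= mulrDl.
have xy : (`|x| <= Num.max `|x| `|y|) && (`|y| <= Num.max `|x| `|y|).
  by have /orP[h|h] := real_leVge (normr_real x) (normr_real y);
     rewrite ?(max_r h) ?(max_l h) ?lexx ?h.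
have [xm ym] := andP xy.
rewrite maxEle; case: ifP => _.
  rewrite -[leLHS]add0r lerD ?mulr_ge0 ?opnorm_ge0 ?(le_trans _ xm)//.
  by rewrite (le_trans (opnormP _ _))// ler_wpM2l ?opnorm_ge0.
rewrite -[leLHS]addr0 lerD ?mulr_ge0 ?opnorm_ge0 ?(le_trans _ xm)//.
by rewrite (le_trans (opnormP _ _))// ler_wpM2l ?opnorm_ge0.
Qed.

Definition diag (A : opair) : bop (V * V)%type := mkbop (bounded_linear_diag A).

Let opair_norm (A : opair) : R[i] := `|diag A|.

Let opair_normD A B : opair_norm (A + B) <= opair_norm A + opair_norm B.
Proof.
by rewrite /opair_norm (_ : diag (A + B) = diag A + diag B) ?ler_normD//; exact: bopE.
Qed.

Let opair_normZ a A : opair_norm (a *: A) = `|a| * opair_norm A.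
Proof.
apply: opnorm_scale => -[x y]; rewrite !prod_normE /=.
rewrite -[`|(a *: A).1 x|]/(`|a *: A.1 x|) -[`|(a *: A).2 y|]/(`|a^* *: A.2 y|).
by rewrite !normrZ norm_conjC maxr_pMr.
Qed.

Let opair_norm0_eq0 A : opair_norm A = 0 -> A = 0.
Proof.
move=> /opnorm0_eq0 A0.
have A0E x y : (A.1 x, A.2 y) = (0, 0) :> V * V.
  by rewrite -[LHS]/(diag A (x, y)) A0.
case: A A0 A0E => A1 A2 _ /= A0E.
suff [-> ->] : A1 = 0 /\ A2 = 0 by [].
by split; apply: bopE => x; [have [] := A0E x 0|have [] := A0E 0 x].
Qed.

(* B(V (+) V) is used only for its norm: `diag` is real-linear but turns the
   scalar action of pairs into (a A.1, a^* A.2) *)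
HB.instance Definition _ := Lmodule_isNormed.Build R[i] opair
  opair_normD opair_normZ opair_norm0_eq0.

Lemma opair_normE A : `|A| = `|diag A|. Proof. by []. Qed.

Definition opmul (A A' : opair) : opair := (bcomp A.1 A'.1, bcomp A'.2 A.2).

Definition opmulr (B B' : opair) : opair := (bcomp B'.1 B.1, bcomp B.2 B'.2).

Definition opbar (A : opair) : opair := (A.2, A.1).

End OperatorPairs.

Section LinearSpan.
Variables (K : nzRingType) (V : lmodType K).

Definition linear_span (S : set V) : set V :=
  [set v | exists n (a : 'I_n -> K) (s : 'I_n -> V),
     (forall i, S (s i)) /\ v = \sum_(i < n) a i *: s i].

End LinearSpan.

Section StandardEmbedding.
Variables (R : realType) (M : cstarTernaryRingType R).

Lemma bounded_linear_tri3 (x y : M) : bounded_linear (tri x y).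
Proof.
by split=> [a z z'|]; [exact: tri_linear3|exists (`|x| * `|y|); exact: tri_norm_le].
Qed.

Lemma bounded_linear_tri1 (y z : M) : bounded_linear (fun x => tri x y z).
Proof.
split=> [a x x'|]; first exact: tri_linear1.
by exists (`|y| * `|z|) => x; rewrite mulrC mulrA tri_norm_le.
Qed.

Definition ell (g h : M) : opair M :=
  (mkbop (bounded_linear_tri3 g h), mkbop (bounded_linear_tri3 h g)).

Definition err (g h : M) : opair M :=
  (mkbop (bounded_linear_tri1 g h), mkbop (bounded_linear_tri1 h g)).

Definition Lop : set (opair M) :=
  closure (linear_span [set ell g h | g in [set: M] & h in [set: M]]).

Definition Rop : set (opair M) :=
  closure (linear_span [set err g h | g in [set: M] & h in [set: M]]).

(* All 2 x 2 matrices, stored by rows, with the maximum of the norms of the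
   entries; those whose diagonal entries are in L(M) and R(M) form `Aemb`. *)
Definition blockmat : Type := ((opair M * M) * (conj_space M * opair M))%type.

HB.instance Definition _ := NormedModule.copy blockmat
  ((opair M * M) * (conj_space M * opair M))%type.

Implicit Types X Y : blockmat.

Definition mx11 X : opair M := X.1.1.
Definition mx12 X : M := X.1.2.
Definition mx21 X : conj_space M := X.2.1.
Definition mx22 X : opair M := X.2.2.

Definition mkmat (A : opair M) (f : M) (g' : conj_space M) (B : opair M) :
  blockmat := ((A, f), (g', B)).

Definition Aemb : set blockmat := [set X | Lop (mx11 X) /\ Rop (mx22 X)].

Definition mxmul X Y : blockmat :=
  mkmat
    (opmul (mx11 X) (mx11 Y) + ell (mx12 X) (unbar (mx21 Y)))
    ((mx11 X).1 (mx12 Y) + (mx22 Y).1 (mx12 X))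
    (bar ((mx11 Y).2 (unbar (mx21 X))) + bar ((mx22 X).2 (unbar (mx21 Y))))
    (err (unbar (mx21 X)) (mx12 Y) + opmulr (mx22 X) (mx22 Y)).

Definition mxsharp X : blockmat :=
  mkmat (opbar (mx11 X)) (unbar (mx21 X)) (bar (mx12 X)) (opbar (mx22 X)).

Definition ternary_ideal (I : set M) : Prop :=
  GRing.submod_closed (mem I) /\
  forall x y z,
    [/\ I z -> I (tri x y z), I x -> I (tri x y z) & I y -> I (tri x y z)].

Definition closed_ternary_ideal (I : set M) : Prop := ternary_ideal I /\ closed I.

Definition two_sided_ideal (J : set blockmat) : Prop :=
  [/\ J `<=` Aemb, GRing.submod_closed (mem J) &
      forall X Y, Aemb X -> J Y -> J (mxmul X Y) /\ J (mxmul Y X)].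

Definition self_adjoint (J : set blockmat) : Prop :=
  forall X, J X -> J (mxsharp X).

(* Hence a subset of `Aemb` is closed in `Aemb` iff it is closed in `blockmat`. *)
Lemma closed_Aemb : closed Aemb.
Proof.
have c11 : continuous (fun X : blockmat => X.1.1).
  by move=> X; apply: continuous_comp; exact: cvg_fst.
have c22 : continuous (fun X : blockmat => X.2.2).
  by move=> X; apply: continuous_comp; exact: cvg_snd.
apply: (@closedI _ ((fun X : blockmat => X.1.1) @^-1` Lop)
                   ((fun X : blockmat => X.2.2) @^-1` Rop)).
  by apply: closed_comp => [X _|]; [exact: c11|exact: closed_closure].
by apply: closed_comp => [X _|]; [exact: c22|exact: closed_closure].
Qed.

Definition closed_self_adjoint_ideal (J : set blockmat) : Prop :=
  [/\ two_sided_ideal J, closed J & self_adjoint J].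

Definition hatL (I : set M) : set (opair M) :=
  closure (linear_span [set ell f g | f in I & g in I]).

Definition hatR (I : set M) : set (opair M) :=
  closure (linear_span [set err f g | f in I & g in I]).

Definition hatA (I : set M) : set blockmat :=
  [set X | [/\ hatL I (mx11 X), I (mx12 X), I (unbar (mx21 X)) & hatR I (mx22 X)]].

End StandardEmbedding.

(* Main.v *)
Require Import Defs.
From mathcomp Require Import all_boot all_order all_algebra.
From mathcomp Require Import complex lra ring.
From mathcomp Require Import all_classical all_reals.
From mathcomp Require Import topology normedtype.

(** The only analytic point is that ell(f, g) and r(f, g) lie in the closed
    spans built from I as soon as one of f, g is in I. If g = [g g w] with w in
    I, then ell(f, g) = ell([f w g], g) and r(f, g) = r([g g f], w), so it is
    enough to approximate every x in I by triple products [x x w] with w in I.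
    Let T = [x x .], V = 1 + icT with c > 0 small, and P = (1/n) sum_{j<n} V^j.
    The C*-identity |y|^3 = |[y y y]| gives |V^j|^2 <= |(1 + c^2 T^2)^j|, which
    stays bounded by 2 when n c^2 |x|^4 <= 1/2; since PT = (V^n - 1) / (icn), the
    same identity applied to y = P x yields |P x|^3 <= 12 |x| / (cn). Finally
    x - P x = [x x w] with w in I, and cn may be taken arbitrarily large. *)

Set Implicit Arguments.
Unset Strict Implicit.
Unset Printing Implicit Defensive.

Import Order.TTheory GRing.Theory Num.Theory.
Import numFieldNormedType.Exports.

Local Open Scope classical_set_scope.
Local Open Scope ring_scope.

(** * Real-valued form of the norm *)

Section RealNorm.
Variables (R : realType) (V : normedModType R[i]).
Implicit Types x y : V.

(** Norms take values in [R[i]]; their copy in the ordered field [R] is open to real arithmetic and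
    to [lra] and [nra]. *)
Definition rnorm x : R := complex.Re `|x|.

Lemma rnormE x : `|x| = (rnorm x)%:C%C.
Proof. by rewrite -Re_normK. Qed.

Lemma rnorm_ge0 x : 0 <= rnorm x.
Proof. by rewrite -ler0c -rnormE. Qed.

Lemma rnorm_le x (k : R) : (rnorm x <= k) = (`|x| <= k%:C%C).
Proof. by rewrite rnormE lecR. Qed.

Lemma rnormD x y : rnorm (x + y) <= rnorm x + rnorm y.
Proof. by rewrite rnorm_le rmorphD /= -!rnormE ler_normD. Qed.

Lemma rnormN x : rnorm (- x) = rnorm x.
Proof. by rewrite /rnorm normrN. Qed.

Lemma rnormZ (a : R) x : rnorm (a%:C%C *: x) = `|a| * rnorm x.
Proof. by rewrite /rnorm normrZ normc_def /= expr0n addr0 sqrtr_sqr rnormE -rmorphM. Qed.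

Lemma rnormZi (a : R) x : rnorm ('i%C * a%:C%C *: x) = `|a| * rnorm x.
Proof.
rewrite -rnormZ /rnorm !normrZ normrM.
by rewrite (_ : `|'i%C : R[i]| = 1) ?mul1r// normc_def /= expr0n expr1n add0r sqrtr1.
Qed.

Lemma rnorm_sum n (F : 'I_n -> V) (k : R) :
  (forall i, rnorm (F i) <= k) -> rnorm (\sum_(i < n) F i) <= n%:R * k.
Proof.
elim: n F => [|n IH] F Fk.
  by rewrite big_ord0 mul0r /rnorm normr0.
by rewrite big_ord_recr /= -natr1 mulrDl mul1r (le_trans (rnormD _ _))// lerD// IH.
Qed.

(** Balls have radii in [R[i]], but a positive element there is real, so real radii already give a
    basis of neighbourhoods. *)
Lemma closure_rnorm (S : set V) x :
  (forall e : R, 0 < e -> exists2 y, S y & rnorm (x - y) < e) -> closure S x.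
Proof.
move=> xS B /nbhs_ballP[e /= e0 eB].
have eE : e = (complex.Re e)%:C%C by rewrite RRe_real// gtr0_real.
have [|y Sy xy] := xS (complex.Re e); first by rewrite -ltcR -eE.
exists y; split=> //; apply: eB.
by rewrite -ball_normE /= rnormE eE ltcR.
Qed.

Lemma rnorm_closure (S : set V) x (e : R) :
  closure S x -> 0 < e -> exists2 y, S y & rnorm (x - y) < e.
Proof.
move=> xS e0; have [|y [Sy xy]] := xS (ball x e%:C%C).
  by apply: nbhsx_ballx; rewrite ltcR.
by exists y => //; move: xy; rewrite -ball_normE /= rnormE ltcR.
Qed.

End RealNorm.

(** * Linear spans and their closures *)

Section ClosedSpan.
Variable (R : realType).

Lemma submod_closedE (V : lmodType R[i]) (S : set V) :
  GRing.submod_closed (mem S) <->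
  S 0 /\ forall a x y, S x -> S y -> S (a *: x + y).
Proof.
split=> -[S0 SD]; split; rewrite ?inE// in S0 *.
  by move=> a x y Sx Sy; have := SD a x y; rewrite !inE; apply.
by move=> a x y; rewrite !inE; exact: SD.
Qed.

Lemma linear_span_submod (V : lmodType R[i]) (S : set V) :
  GRing.submod_closed (mem (linear_span S)).
Proof.
apply/submod_closedE; split.
  exists 0, (fun=> 0), (fun=> 0); split; first by case.
  by rewrite big_ord0.
move=> a x y [n [b [s [sS ->]]]] [m [c [t [tS ->]]]].
exists (n + m), (fun i => match fintype.split i with inl j => a * b j | inr j => c j end),
  (fun i => match fintype.split i with inl j => s j | inr j => t j end).
split=> [i|]; first by case: (fintype.split i).
rewrite big_split_ord scaler_sumr; congr (_ + _); apply: eq_bigr => i _.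
  case: fintype.splitP => [j /= /ord_inj <-|j /= ij]; [by rewrite scalerA|].
  by have := ltn_ord i; rewrite ij ltnNge leq_addr.
case: fintype.splitP => [j /= ij|j /= /addnI/ord_inj <-]//.
by have := ltn_ord j; rewrite -ij ltnNge leq_addr.
Qed.

Lemma closure_submod (V : normedModType R[i]) (S : set V) :
  GRing.submod_closed (mem S) -> GRing.submod_closed (mem (closure S)).
Proof.
move=> /submod_closedE[S0 SD]; apply/submod_closedE; split; first exact: subset_closure.
move=> a x y xS yS; apply: closure_rnorm => e e0.
have aE : `|a| = (complex.Re `|a|)%:C%C by rewrite RRe_real// normr_real.
have a0 : 0 <= complex.Re `|a| by rewrite -ler0c -aE.
have a1 : 0 < complex.Re `|a| + 1 by rewrite ltr_wpDl.
(* The summand 1 keeps the denominator positive when a = 0. *)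
have [|x' Sx' xx'] := rnorm_closure xS (e := e / 2 / (complex.Re `|a| + 1)).
  by rewrite !divr_gt0.
have [|y' Sy' yy'] := rnorm_closure yS (e := e / 2); first by rewrite divr_gt0.
exists (a *: x' + y'); first exact: SD.
rewrite opprD addrACA -scalerBr (le_lt_trans (rnormD _ _))//.
rewrite [ltRHS](splitr e) ler_ltD//.
rewrite rnorm_le normrZ rnormE.
rewrite aE -rmorphM lecR /=; move: xx'; rewrite ltr_pdivlMr// => /ltW; apply: le_trans.
by rewrite mulrC ler_wpM2l ?rnorm_ge0// lerDl.
Qed.

Lemma linear_span_sub (V : lmodType R[i]) (S : set V) : S `<=` linear_span S.
Proof.
move=> x Sx; exists 1, (fun=> 1), (fun=> x); split=> //.
by rewrite big_ord1 scale1r.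
Qed.

(* [sigma] is there for the maps that are conjugate-linear. *)
Lemma closed_span_image (V W : normedModType R[i]) (F : V -> W) (sigma : R[i] -> R[i])
    (k : R) (S : set V) (C : set W) :
  {morph F : x y / x - y} -> (forall a x, F (a *: x) = sigma a *: F x) ->
  (forall x, rnorm (F x) <= k * rnorm x) ->
  GRing.submod_closed (mem C) -> closed C -> (forall s, S s -> C (F s)) ->
  forall x, closure (linear_span S) x -> C (F x).
Proof.
move=> FB FZ Fk /submod_closedE[C0 CD] clC SC x xS; apply: clC; apply: closure_rnorm => e e0.
have F0 : F 0 = 0 by rewrite -(subr0 0) FB subrr.
have FN y : F (- y) = - F y by rewrite -sub0r FB F0 sub0r.
have FD y z : F (y + z) = F y + F z by rewrite -{1}(opprK z) FB FN opprK.
(* The constant |k| + 1 is a positive Lipschitz bound for [F], whatever the sign of k. *)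
have k1 : 0 < `|k| + 1 by rewrite ltr_wpDl.
have [|y [n [a [s [sS yE]]]] xy] := rnorm_closure xS (e := e / (`|k| + 1)).
  by rewrite divr_gt0.
exists (F y).
  rewrite {}yE {xy}; elim: n a s sS => [|n IH] a s sS.
    by rewrite big_ord0 F0.
  rewrite big_ord_recl FD FZ.
  by apply: CD; [exact: SC|exact: IH].
rewrite -FB (le_lt_trans (Fk _))//.
move: xy; rewrite ltr_pdivlMr// => /(le_lt_trans _); apply.
rewrite mulrC ler_wpM2l ?rnorm_ge0// (le_trans (ler_norm k))// lerDl//.
Qed.

End ClosedSpan.

(** * Power bounds for the perturbations 1 + icT of the identity, T = [x x .] *)

Section Cubic.
Variables (R : realType) (M : cstarTernaryRingType R).
Implicit Types (x y z u v : M).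

Lemma rnorm_tri x y z : rnorm (tri x y z) <= rnorm x * rnorm y * rnorm z.
Proof. by rewrite rnorm_le !rmorphM /= -!rnormE tri_norm_le. Qed.

Lemma rnorm_cube x : rnorm (tri x x x) = rnorm x ^+ 3.
Proof. by rewrite {1}/rnorm tri_norm_cube rnormE -rmorphXn. Qed.

Lemma triDl x x' y z : tri (x + x') y z = tri x y z + tri x' y z.
Proof. by have := tri_linear1 1 x x' y z; rewrite !scale1r. Qed.

Lemma triDm x y y' z : tri x (y + y') z = tri x y z + tri x y' z.
Proof. by have := tri_conjlinear2 1 x y y' z; rewrite !scale1r rmorph1 scale1r. Qed.

Lemma triDr x y z z' : tri x y (z + z') = tri x y z + tri x y z'.
Proof. by have := tri_linear3 1 x y z z'; rewrite !scale1r. Qed.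

Lemma tri0l y z : tri 0 y z = 0 :> M.
Proof. by apply: (addIr (tri 0 y z)); rewrite -triDl !add0r. Qed.

Lemma tri0m x z : tri x 0 z = 0 :> M.
Proof. by apply: (addIr (tri x 0 z)); rewrite -triDm !add0r. Qed.

Lemma tri0r x y : tri x y 0 = 0 :> M.
Proof. by apply: (addIr (tri x y 0)); rewrite -triDr !add0r. Qed.

Lemma triZl a x y z : tri (a *: x) y z = a *: tri x y z.
Proof. by have := tri_linear1 a x 0 y z; rewrite !addr0 tri0l addr0. Qed.

Lemma triZm a x y z : tri x (a *: y) z = a^* *: tri x y z.
Proof. by have := tri_conjlinear2 a x y 0 z; rewrite !addr0 tri0m addr0. Qed.

Lemma triZr a x y z : tri x y (a *: z) = a *: tri x y z.
Proof. by have := tri_linear3 a x y z 0; rewrite !addr0 tri0r addr0. Qed.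

(** The hypothesis, taken at the norm k of [U], gives k^3 <= 2k, so k is at most the square root of
    2. The bound 2 is cruder and avoids roots. *)
Lemma bop_cubic_bound (U : bop M) (C : R) : C <= 2 ->
  (forall k : R, 0 <= k -> (forall z, rnorm (U z) <= k * rnorm z) ->
     forall z, rnorm (U z) ^+ 3 <= k * C * rnorm z ^+ 3) ->
  forall z, rnorm (U z) <= 2 * rnorm z.
Proof.
move=> C2 UC.
pose k := complex.Re (opnorm U).
have kE : opnorm U = k%:C%C by rewrite RRe_real// ger0_real// opnorm_ge0.
have k0 : 0 <= k by rewrite -ler0c -kE opnorm_ge0.
have kP z : rnorm (U z) <= k * rnorm z.
  by rewrite rnorm_le rmorphM /= -rnormE -kE opnormP.
have [k2|k2] := leP k 2.
  by move=> z; rewrite (le_trans (kP z))// ler_wpM2r ?rnorm_ge0.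
(* If k > 2, then 2k <= (4k/5)^3 because 4 (4/5)^3 = 256/125 > 2; so the norm k would be at most
   4k/5, which is absurd. *)
suff: k <= 4 / 5 * k by lra.
rewrite -lecR -kE; apply: opnorm_le => [|z].
  by rewrite ler0c; lra.
rewrite [X in _ * X]rnormE -rmorphM -rnorm_le /=.
have := UC k k0 kP z; have := rnorm_ge0 z; have := rnorm_ge0 (U z).
move: (rnorm (U z)) (rnorm z) => a b a0 b0 ab.
rewrite -(@ler_pXn2r _ 3)// ?nnegrE ?mulr_ge0//; try lra.
apply: (le_trans ab); rewrite [leRHS]exprMn; apply: ler_wpM2r; first exact: exprn_ge0.
nra.
Qed.

(** A Bernoulli-type estimate: (1 + b)^j (1 - jb) <= 1 by induction, and the second factor is at
    least 1/2. *)
Lemma expr1D_le2 (b : R) j : 0 <= b -> j%:R * b <= 1 / 2 -> (1 + b) ^+ j <= 2.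
Proof.
move=> b0 jb.
have H : (1 + b) ^+ j * (1 - j%:R * b) <= 1.
  elim: j {jb} => [|j IH]; first by rewrite expr0 mul0r subr0 mulr1.
  apply: le_trans IH; rewrite exprSr -mulrA ler_wpM2l ?exprn_ge0 ?addr_ge0//.
  have : 0 <= j%:R :> R by [].
  by rewrite -natr1; nra.
have : 0 <= (1 + b) ^+ j by rewrite exprn_ge0// addr_ge0.
nra.
Qed.

Variable x : M.

(** The operator V = 1 + icT of the overview. The imaginary coefficient makes [pert (- c)] its
    formal adjoint for the triple product and cancels the first-order terms of V'V. *)
Definition pert (c : R) z : M := z + ('i%C * c%:C%C) *: tri x x z.

Lemma pertD c : {morph pert c : z u / z + u}.
Proof. by move=> z u; rewrite /pert triDr scalerDr addrACA. Qed.

Lemma pertZ c a z : pert c (a *: z) = a *: pert c z.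
Proof. by rewrite /pert triZr scalerDr !scalerA [a * _]mulrC. Qed.

Lemma pert_tril c u v w : tri (pert c u) v w = pert c (tri u v w).
Proof. by rewrite /pert triDl triZl tri_assoc_right. Qed.

Lemma pert_trim c u v w : tri u (pert c v) w = tri u v (pert (- c) w).
Proof.
(* The conjugate of ic is -ic, and T itself passes from the middle slot to the last one by both
   associativity laws, through [[u v x] x w]. *)
rewrite /pert triDm triZm triDr triZr; congr (_ + _ *: _).
  have E a b : (a +i* b)%C^* = (a -i* b)%C by [].
  by rewrite (_ : 'i%C * c%:C%C = (0 +i* c)%C) ?E//; simpc.
by rewrite -tri_assoc_mid tri_assoc_right.
Qed.

Lemma tri_pert c z : tri x x (pert c z) = pert c (tri x x z).
Proof. by rewrite /pert triDr triZr. Qed.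

Lemma pertC c d z : pert c (pert d z) = pert d (pert c z).
Proof. by rewrite {1}/pert tri_pert -pertZ -pertD. Qed.

(** Here (1 - icT)(1 + icT) = 1 + c^2 T^2, and T has norm at most |x|^2. *)
Lemma rnorm_pertN c z :
  rnorm (pert (- c) (pert c z)) <= (1 + c ^+ 2 * rnorm x ^+ 4) * rnorm z.
Proof.
have -> : pert (- c) (pert c z) = z + (c ^+ 2)%:C%C *: tri x x (tri x x z).
  rewrite /pert triDr triZr scalerDr addrACA scalerA -addrA; congr (_ + _).
  rewrite addrA -scalerDl rmorphN mulrN addNr scale0r add0r; congr (_ *: _).
  by rewrite mulNr mulrACA -expr2 sqr_i mulN1r opprK rmorphXn.
rewrite (le_trans (rnormD _ _))// mulrDl mul1r lerD2l rnormZ ger0_norm ?sqr_ge0//.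
rewrite -mulrA ler_wpM2l ?sqr_ge0//.
rewrite (le_trans (rnorm_tri _ _ _))// (_ : 4 = 2 + 2)%N// exprD -[leRHS]mulrA expr2.
by rewrite ler_wpM2l ?mulr_ge0 ?rnorm_ge0// rnorm_tri.
Qed.

Lemma bounded_linear_iter_pert c j : bounded_linear (iter j (pert c)).
Proof.
have pb : bounded_linear (pert c).
  split=> [a z u|]; first by rewrite pertD pertZ.
  exists (1 + `|'i%C * c%:C%C : R[i]| * (`|x| * `|x|)) => z.
  rewrite (le_trans (ler_normD _ _))// mulrDl mul1r lerD2l normrZ -mulrA.
  by rewrite ler_wpM2l// tri_norm_le.
elim: j => [|j IH] /=; last exact: (bounded_linear_comp (mkbop pb) (mkbop IH)).
by split=> //; exists 1 => z; rewrite mul1r.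
Qed.

Lemma iter_pert_tril c j u v w :
  tri (iter j (pert c) u) v w = iter j (pert c) (tri u v w).
Proof. by elim: j => //= j <-; rewrite pert_tril. Qed.

Lemma iter_pert_trim c j u v w :
  tri u (iter j (pert c) v) w = tri u v (iter j (pert (- c)) w).
Proof. by elim: j w => //= j IH w; rewrite pert_trim IH -iterSr. Qed.

Lemma tri_iter_pert c j z : tri x x (iter j (pert c) z) = iter j (pert c) (tri x x z).
Proof. by elim: j => //= j <-; rewrite tri_pert. Qed.

Lemma rnorm_iter_pertN c j z :
  rnorm (iter j (pert (- c)) (iter j (pert c) z))
    <= (1 + c ^+ 2 * rnorm x ^+ 4) ^+ j * rnorm z.
Proof.
elim: j z => [|j IH] z; first by rewrite expr0 mul1r.
rewrite iterSr iterS -[pert (- c) _]/(iter 1 (pert (- c)) _).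
(* The pair (1 - icT)(1 + icT) is moved inside V^j, all factors being polynomials in T; the
   induction hypothesis then applies to its image of z. *)
have -> : iter 1 (pert (- c)) (pert c (iter j (pert c) z)) =
          iter j (pert c) (pert (- c) (pert c z)).
  by elim: j {IH} => //= j <-; rewrite pertC.
have b0 : 0 <= c ^+ 2 * rnorm x ^+ 4 by rewrite mulr_ge0 ?sqr_ge0 ?exprn_ge0 ?rnorm_ge0.
rewrite (le_trans (IH _))// [_ ^+ j.+1]exprSr -[leRHS]mulrA ler_wpM2l ?rnorm_pertN//.
by rewrite exprn_ge0// addr_ge0.
Qed.

(* With U = (1 + icT)^j and T = [xx.], the element U'U is (1 + c^2 T^2)^j and
   |Uz|^3 = |[Uz Uz Uz]| = |U[z z U'Uz]| <= |U| |U'U| |z|^3, so that |U|^2 <= |U'U|. *)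
Lemma rnorm_iter_pert c n j z : (j <= n)%N ->
  n%:R * (c ^+ 2 * rnorm x ^+ 4) <= 1 / 2 ->
  rnorm (iter j (pert c) z) <= 2 * rnorm z.
Proof.
move=> jn nc; set b := c ^+ 2 * rnorm x ^+ 4 in nc.
have b0 : 0 <= b by rewrite mulr_ge0 ?sqr_ge0 ?exprn_ge0 ?rnorm_ge0.
have C2 : (1 + b) ^+ j <= 2.
  by apply: expr1D_le2 => //; rewrite (le_trans _ nc)// ler_wpM2r// ler_nat.
apply: (@bop_cubic_bound (mkbop (bounded_linear_iter_pert c j)) _ C2) => k k0 /= kU {}z.
rewrite -rnorm_cube iter_pert_tril iter_pert_trim (le_trans (kU _))// -mulrA ler_wpM2l//.
rewrite (le_trans (rnorm_tri _ _ _))// [rnorm z ^+ 3]exprSr expr2 [leRHS]mulrCA.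
by rewrite ler_wpM2l ?mulr_ge0 ?rnorm_ge0// rnorm_iter_pertN.
Qed.

End Cubic.

(** * Averages P of the powers of V, and the smallness of P x *)

Section Average.
Variables (R : realType) (M : cstarTernaryRingType R) (x : M).
Implicit Types (z u v w : M) (c : R).

Definition avg c n z : M := (n%:R^-1)%:C%C *: \sum_(j < n) iter j (pert x c) z.

Lemma tri_suml n (F : 'I_n -> M) u v :
  tri (\sum_(i < n) F i) u v = \sum_(i < n) tri (F i) u v.
Proof. exact: (big_morph (fun z => tri z u v) (fun z z' => triDl z z' u v) (tri0l u v)). Qed.

Lemma tri_summ n (F : 'I_n -> M) u v :
  tri u (\sum_(i < n) F i) v = \sum_(i < n) tri u (F i) v.
Proof. exact: (big_morph (fun z => tri u z v) (fun z z' => triDm u z z' v) (tri0m u v)). Qed.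

Lemma tri_sumr n (F : 'I_n -> M) u v :
  tri u v (\sum_(i < n) F i) = \sum_(i < n) tri u v (F i).
Proof. exact: (big_morph (tri u v) (triDr u v) (tri0r u v)). Qed.

Lemma avg_tril c n u v w : tri (avg c n u) v w = avg c n (tri u v w).
Proof.
by rewrite /avg triZl tri_suml; congr (_ *: _); apply: eq_bigr => j _; rewrite iter_pert_tril.
Qed.

Lemma avg_trim c n u v w : tri u (avg c n v) w = tri u v (avg (- c) n w).
Proof.
rewrite /avg triZm triZr tri_summ tri_sumr; congr (_ *: _).
  exact: conjc_real.
by apply: eq_bigr => j _; rewrite iter_pert_trim.
Qed.

Lemma tri_avg c n z : tri x x (avg c n z) = avg c n (tri x x z).
Proof.
by rewrite /avg triZr tri_sumr; congr (_ *: _); apply: eq_bigr => j _; rewrite tri_iter_pert.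
Qed.

Lemma rnorm_avg c n z : (0 < n)%N ->
  n%:R * (c ^+ 2 * rnorm x ^+ 4) <= 1 / 2 -> rnorm (avg c n z) <= 2 * rnorm z.
Proof.
move=> n0 nc; have n0R : 0 < n%:R :> R by rewrite ltr0n.
rewrite rnormZ ger0_norm ?invr_ge0 ?ler0n// ler_pdivrMl//.
by apply: rnorm_sum => j; exact: (rnorm_iter_pert _ (ltnW (ltn_ord j))).
Qed.

(** The sum telescopes, since icT V^j = V^(j+1) - V^j. *)
Lemma tri_sum_iter_pert c n z :
  ('i%C * c%:C%C) *: tri x x (\sum_(j < n) iter j (pert x c) z) = iter n (pert x c) z - z.
Proof.
elim: n => [|n IH]; first by rewrite big_ord0 tri0r scaler0 subrr.
by rewrite big_ord_recr /= triDr scalerDr {}IH [in RHS]/pert addrAC.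
Qed.

(** Telescoping gives T P = (V^n - 1) / (icn); the constant 3 is 2 + 1, from the bound 2 on V^n and
    the term z. *)
Lemma rnorm_tri_avg c n z : (0 < n)%N -> 0 < c ->
  n%:R * (c ^+ 2 * rnorm x ^+ 4) <= 1 / 2 ->
  rnorm (tri x x (avg c n z)) <= 3 / (n%:R * c) * rnorm z.
Proof.
move=> n0 c0 nc; have n0R : 0 < n%:R :> R by rewrite ltr0n.
have : rnorm (('i%C * c%:C%C) *: tri x x (\sum_(j < n) iter j (pert x c) z)) <= 3 * rnorm z.
  rewrite tri_sum_iter_pert (le_trans (rnormD _ _))// rnormN.
  by have := rnorm_iter_pert z (leqnn n) nc; lra.
rewrite rnormZi gtr0_norm// => H.
rewrite /avg triZr rnormZ ger0_norm ?invr_ge0 ?ler0n//.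
rewrite ler_pdivrMl// (_ : _ * (_ * _) = 3 * rnorm z / c); last by field; rewrite !gt_eqF.
by rewrite ler_pdivlMr// mulrC.
Qed.

(* [y y y] = P P' P T x for y = P x, with P the average, P' its conjugate and
   T = [xx.]; the factor P T is the small one. *)
Lemma rnorm_avg_cube c n : (0 < n)%N -> 0 < c ->
  n%:R * (c ^+ 2 * rnorm x ^+ 4) <= 1 / 2 ->
  rnorm (avg c n x) ^+ 3 <= 12 / (n%:R * c) * rnorm x.
Proof.
move=> n0 c0 nc; have nc' : n%:R * ((- c) ^+ 2 * rnorm x ^+ 4) <= 1 / 2 by rewrite sqrrN.
rewrite -rnorm_cube avg_tril avg_trim !tri_avg.
(* The constant 12 is 2 * 2 * 3: a factor 2 for each of P and P', and 3 from P T. *)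
have := rnorm_avg (avg (- c) n (avg c n (tri x x x))) n0 nc.
have := rnorm_avg (avg c n (tri x x x)) n0 nc'.
have := rnorm_tri_avg x n0 c0 nc; rewrite tri_avg.
lra.
Qed.

End Average.

(** * Approximation of elements of an ideal by triple products *)

Section TripleIdeal.
Variables (R : realType) (M : cstarTernaryRingType R) (I : set M).
Hypothesis idealI : ternary_ideal I.

Let I0 : I 0. Proof. by have [/submod_closedE[]] := idealI. Qed.
Let ID a u v : I u -> I v -> I (a *: u + v).
Proof. by have [/submod_closedE[_ H] _] := idealI; exact: H. Qed.
Let It u v w : I w -> I (tri u v w).
Proof. by have [_ /(_ u v w)[]] := idealI. Qed.

Lemma ideal_avg_range (x : M) c n : (0 < n)%N -> I x ->
  exists2 w, I w & x - avg x c n x = tri x x w.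
Proof.
move=> n0 Ix.
have IN u : I u -> I (- u) by move=> Iu; rewrite -scaleN1r -[_ *: _]addr0; exact: ID.
have Iadd u v : I u -> I v -> I (u + v) by move=> Iu; rewrite -(scale1r u); exact: ID.
have Iscale a u : I u -> I (a *: u) by move=> Iu; rewrite -[_ *: _]addr0; exact: ID.
have Ipert j : I (iter j (pert x c) x).
  by elim: j => //= j IH; apply: Iadd => //; apply/Iscale/It.
have Isum m (F : 'I_m -> M) : (forall i, I (F i)) -> I (\sum_(i < m) F i).
  by move=> FI; elim/big_ind: _.
(* Averaging 1 - V^j = -icT (1 + V + ... + V^(j-1)) over j < n writes 1 - P as T times a polynomial
   in T; the witness is the value of that polynomial at x, which stays in [I]. *)
exists (- ((n%:R^-1)%:C%C *: \sum_(j < n) ('i%C * c%:C%C) *: \sum_(k < j) iter k (pert x c) x)).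
  by apply/IN/Iscale/Isum => j; apply/Iscale/Isum => k.
rewrite -[in RHS]scaleN1r triZr scaleN1r triZr tri_sumr.
under [in RHS]eq_bigr => j _ do rewrite triZr tri_sum_iter_pert.
rewrite sumrB scalerBr opprB sumr_const card_ord /avg -[x *+ n]scaler_nat scalerA.
have -> : (n%:R^-1)%:C%C * n%:R = 1 :> R[i].
  by rewrite fmorphV rmorph_nat mulVf// pnatr_eq0 -lt0n.
by rewrite scale1r.
Qed.

Lemma ideal_approx (x : M) (e : R) : 0 < e -> I x ->
  exists2 w, I w & rnorm (x - tri x x w) < e.
Proof.
move=> e0 Ix.
(* s is the value of cn: it makes 12 |x| / (cn) < e^3, and the summand 1 gives s > 0 and strictness
   even for x = 0. *)
pose s := 12 * (rnorm x + 1) / e ^+ 3.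
have e3 : 0 < e ^+ 3 by rewrite exprn_gt0.
have x0 := rnorm_ge0 x.
have s0 : 0 < s by rewrite divr_gt0// mulr_gt0//; lra.
(* With c = s/n, the quantity n c^2 |x|^4 equals t / (2n), which is at most 1/2 as soon as n > t. *)
pose t := 2 * s ^+ 2 * rnorm x ^+ 4.
have t0 : 0 <= t by rewrite mulr_ge0 ?exprn_ge0// mulr_ge0 ?sqr_ge0.
pose n := (Num.truncn t).+1.
have tn : t < n%:R by exact: truncnS_gt.
have n0 : 0 < n%:R :> R by exact: le_lt_trans tn.
have [w Iw xw] := @ideal_avg_range x (s / n%:R) n isT Ix.
exists w => //; rewrite -xw opprB addrC subrK.
rewrite -(@ltr_pXn2r _ 3)// ?nnegrE ?rnorm_ge0 ?(ltW e0)//.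
have [] : 0 < s / n%:R /\ n%:R * ((s / n%:R) ^+ 2 * rnorm x ^+ 4) <= 1 / 2.
  split; first exact: divr_gt0.
  rewrite (_ : _ * _ = t / 2 / n%:R); last by rewrite /t; field; rewrite gt_eqF.
  by rewrite ler_pdivrMr//; lra.
move=> c0 nc; apply: (le_lt_trans (rnorm_avg_cube (ltn0Sn _) c0 nc)).
rewrite (_ : n%:R * _ = s); last by field; rewrite gt_eqF.
rewrite mulrAC ltr_pdivrMr// (_ : _ * s = 12 * (rnorm x + 1)).
  by lra.
by rewrite /s; field; rewrite gt_eqF.
Qed.

End TripleIdeal.

(** * Norm estimates and bilinearity of the product for pairs of operators *)

Section PairNorm.
Variables (R : realType) (V : normedModType R[i]).
Implicit Types (A B : opair V) (x : V).

Lemma rnorm_pair (W : normedModType R[i]) (x : V * W) :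
  rnorm x = Num.max (rnorm x.1) (rnorm x.2).
Proof. by rewrite {1}/rnorm prod_normE !rnormE !maxEle lecR; case: ifP. Qed.

Lemma rnorm_opair_le A (k : R) : 0 <= k ->
  (forall x, rnorm (A.1 x) <= k * rnorm x) -> (forall x, rnorm (A.2 x) <= k * rnorm x) ->
  rnorm A <= k.
Proof.
move=> k0 A1 A2; rewrite rnorm_le; apply: opnorm_le => [|[x y]]; first by rewrite ler0c.
rewrite [X in _ * X]rnormE -rmorphM -rnorm_le /= !rnorm_pair /= ge_max.
rewrite (le_trans (A1 _)) ?(le_trans (A2 _))// ler_wpM2l// le_max lexx ?orbT//.
Qed.

Lemma rnorm_opair12 A x y :
  Num.max (rnorm (A.1 x)) (rnorm (A.2 y)) <= rnorm A * Num.max (rnorm x) (rnorm y).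
Proof.
have := opnormP (diag A) (x, y).
by rewrite [X in _ * X]rnormE -[opnorm _]/(`|A|) [`|A|]rnormE -rmorphM -rnorm_le /= !rnorm_pair.
Qed.

Lemma rnorm_opair1 A x : rnorm (A.1 x) <= rnorm A * rnorm x.
Proof. by have := rnorm_opair12 A x x; rewrite maxxx ge_max => /andP[]. Qed.

Lemma rnorm_opair2 A x : rnorm (A.2 x) <= rnorm A * rnorm x.
Proof. by have := rnorm_opair12 A x x; rewrite maxxx ge_max => /andP[]. Qed.

Lemma rnorm_opbar A : rnorm (opbar A) <= rnorm A.
Proof.
apply: rnorm_opair_le => [|x|x]; [exact: rnorm_ge0|exact: rnorm_opair2|exact: rnorm_opair1].
Qed.

Lemma rnorm_opmul A B : rnorm (opmul A B) <= rnorm A * rnorm B.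
Proof.
apply: rnorm_opair_le => [|x|x]; first by rewrite mulr_ge0 ?rnorm_ge0.
  rewrite -mulrA; apply: (le_trans (rnorm_opair1 A (B.1 x))).
  by apply: ler_wpM2l; [exact: rnorm_ge0|exact: rnorm_opair1].
rewrite [rnorm A * rnorm B]mulrC -mulrA; apply: (le_trans (rnorm_opair2 B (A.2 x))).
by apply: ler_wpM2l; [exact: rnorm_ge0|exact: rnorm_opair2].
Qed.

Lemma opmulBl B : {morph (fun A => opmul A B) : A A' / A - A'}.
Proof. by move=> A A'; congr (_, _); apply: bopE => x //=; rewrite linearB. Qed.

Lemma opmulBr A : {morph opmul A : B B' / B - B'}.
Proof. by move=> B B'; congr (_, _); apply: bopE => x //=; rewrite linearB. Qed.

Lemma opmulZl a A B : opmul (a *: A) B = a *: opmul A B.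
Proof. by congr (_, _); apply: bopE => x //=; rewrite linearZ. Qed.

Lemma opmulZr a A B : opmul A (a *: B) = a *: opmul A B.
Proof. by congr (_, _); apply: bopE => x //=; rewrite linearZ. Qed.

End PairNorm.

(** * Closed spans of generators, treated at once for [ell] and [err] *)

Section ClosedSpanOfGenerators.
Variables (R : realType) (M : cstarTernaryRingType R) (E : M -> M -> opair M).
Implicit Types (f g : M) (A B : opair M) (I : set M).

(** For [E] equal to [ell] or [err] this unfolds to [hatL] or [hatR], and at [setT] to [Lop] or
    [Rop]. *)
Definition genspan I : set (opair M) :=
  closure (linear_span [set E f g | f in I & g in I]).

Lemma genspan_submod I : GRing.submod_closed (mem (genspan I)).
Proof. exact/closure_submod/linear_span_submod. Qed.

Lemma genspan_closed I : closed (genspan I).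
Proof. exact: closed_closure. Qed.

Lemma genspan_gen I f g : I f -> I g -> genspan I (E f g).
Proof. by move=> If Ig; apply/subset_closure/linear_span_sub; exists f => //; exists g. Qed.

Lemma genspan_monotone I : genspan I `<=` genspan setT.
Proof.
apply: (@closed_span_image _ _ _ id id 1) => //.
- by move=> A; rewrite mul1r.
- exact: genspan_submod.
- exact: genspan_closed.
- by move=> _ [f _ [g _ <-]]; apply: genspan_gen.
Qed.

Hypothesis E_bar : forall f g, opbar (E f g) = E g f.
Hypothesis EB : forall f g g', E f (g - g') = E f g - E f g'.
Hypothesis rnorm_E : forall f g, rnorm (E f g) <= rnorm f * rnorm g.

Lemma genspan_opbar I A : genspan I A -> genspan I (opbar A).
Proof.
apply: (@closed_span_image _ _ _ (@opbar R M) (fun a => a^* ) 1) => //.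
- by move=> a x; congr (_, _) => /=; rewrite conjCK.
- by move=> x; rewrite mul1r rnorm_opbar.
- exact: genspan_submod.
- exact: genspan_closed.
- by move=> _ [f If [g Ig <-]]; rewrite E_bar; exact: genspan_gen.
Qed.

Variable I : set M.
Hypothesis idealI : closed_ternary_ideal I.

Lemma genspan_opair1 A f : genspan I A -> (forall g h, I g -> I h -> I ((E g h).1 f)) ->
  I (A.1 f).
Proof.
move=> IA H; move: A IA.
have [[smI _] clI] := idealI.
apply: (@closed_span_image _ _ _ (fun A : opair M => A.1 f) id (rnorm f)) => //.
- by move=> A; rewrite mulrC rnorm_opair1.
- by move=> _ [g Ig [h Ih <-]]; exact: H.
Qed.

Hypothesis E_absorb : forall a b f g, I f -> I g -> genspan I (opmul (E a b) (E f g)).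

(** Absorption passes from generators to closed spans in two rounds, by continuity first in [B] with
    [A] fixed, then in [A] with a generator of the ideal fixed. *)
Lemma genspan_opmull A B : genspan setT A -> genspan I B -> genspan I (opmul A B).
Proof.
move=> TA; move: B.
apply: (@closed_span_image _ _ _ (opmul A) id (rnorm A)) => //.
- exact: opmulBr.
- by move=> a x; rewrite opmulZr.
- by move=> B; exact: rnorm_opmul.
- exact: genspan_submod.
- exact: genspan_closed.
move=> _ [f If [g Ig <-]]; move: A TA.
apply: (@closed_span_image _ _ _ (fun A : opair M => opmul A (E f g)) id (rnorm (E f g))) => //.
- exact: opmulBl.
- by move=> a x; rewrite opmulZl.
- by move=> A; rewrite mulrC rnorm_opmul.
- exact: genspan_submod.
- exact: genspan_closed.
- by move=> _ [a _ [b _ <-]]; exact: E_absorb.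
Qed.

(** [opbar] preserves both spans and reverses products, which turns left absorption into right
    absorption. *)
Lemma genspan_opmulr A B : genspan setT A -> genspan I B -> genspan I (opmul B A).
Proof.
by move=> /genspan_opbar TA /genspan_opbar IB; apply: genspan_opbar (genspan_opmull TA IB).
Qed.

Hypothesis E_cube : forall f g w, I g -> I w -> genspan I (E f (tri g g w)).

(** Although f is arbitrary, g is a limit of products [g g w] with w in [I]; [E_cube] handles these,
    and [E f] is Lipschitz. *)
Lemma genspan_genr f g : I g -> genspan I (E f g).
Proof.
move=> Ig; apply: genspan_closed; apply: closure_rnorm => e e0.
have f1 : 0 < rnorm f + 1 by rewrite ltr_wpDl// rnorm_ge0.
have [|w Iw gw] := ideal_approx idealI.1 (e := e / (rnorm f + 1)) _ Ig.
  exact: divr_gt0.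
exists (E f (tri g g w)); first exact: E_cube.
rewrite -EB (le_lt_trans (rnorm_E _ _))//.
move: gw; rewrite ltr_pdivlMr// => /(le_lt_trans _); apply.
by rewrite mulrC ler_wpM2l ?rnorm_ge0// lerDl.
Qed.

Lemma genspan_genl f g : I f -> genspan I (E f g).
Proof. by move=> If; rewrite -E_bar; exact/genspan_opbar/genspan_genr. Qed.

End ClosedSpanOfGenerators.

(** * The block matrices over an ideal of M *)

Section BlockIdeal.
Variables (R : realType) (M : cstarTernaryRingType R).
Implicit Types (f g x y z : M) (A B : opair M).

Lemma triBl x x' y z : tri (x - x') y z = tri x y z - tri x' y z :> M.
Proof. by rewrite triDl -[- x']scaleN1r triZl scaleN1r. Qed.

Lemma triBm x y y' z : tri x (y - y') z = tri x y z - tri x y' z :> M.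
Proof. by rewrite triDm -[- y']scaleN1r triZm rmorphN rmorph1 scaleN1r. Qed.

Lemma triBr x y z z' : tri x y (z - z') = tri x y z - tri x y z' :> M.
Proof. by rewrite triDr -[- z']scaleN1r triZr scaleN1r. Qed.

Lemma ellBr f g g' : ell f (g - g') = ell f g - ell f g'.
Proof. by congr (_, _); apply: bopE => x /=; [exact: triBm|exact: triBl]. Qed.

Lemma errBr f g g' : err f (g - g') = err f g - err f g'.
Proof. by congr (_, _); apply: bopE => x /=; [exact: triBr|exact: triBm]. Qed.

Lemma rnorm_ell f g : rnorm (ell f g) <= rnorm f * rnorm g.
Proof.
apply: rnorm_opair_le => [|x|x] /=; first by rewrite mulr_ge0 ?rnorm_ge0.
  exact: rnorm_tri.
by rewrite [rnorm f * _]mulrC rnorm_tri.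
Qed.

Lemma rnorm_err f g : rnorm (err f g) <= rnorm f * rnorm g.
Proof.
apply: rnorm_opair_le => [|x|x] /=; first by rewrite mulr_ge0 ?rnorm_ge0.
  by rewrite mulrC mulrA rnorm_tri.
by rewrite [leRHS]mulrC [rnorm f * _]mulrC mulrA rnorm_tri.
Qed.

Lemma opmul_ell a b f g : opmul (ell a b) (ell f g) = ell (tri a b f) g.
Proof.
congr (_, _); apply: bopE => x /=; first by rewrite tri_assoc_right.
by rewrite -tri_assoc_mid tri_assoc_right.
Qed.

Lemma opmul_err a b f g : opmul (err a b) (err f g) = err f (tri g a b).
Proof.
congr (_, _); apply: bopE => x /=; first by rewrite tri_assoc_right.
by rewrite tri_assoc_mid.
Qed.

(** On the right both arguments lie in [I] once g does, whatever f is. In [err_tri] the same holds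
    once g and w lie in [I]. *)
Lemma ell_tri f g w : ell f (tri g g w) = ell (tri f w g) g.
Proof. by congr (_, _); apply: bopE => x /=; rewrite -tri_assoc_mid. Qed.

Lemma err_tri f g w : err f (tri g g w) = err (tri g g f) w.
Proof. by congr (_, _); apply: bopE => x /=; rewrite -tri_assoc_mid tri_assoc_right. Qed.

Variable I : set M.
Hypothesis cidealI : closed_ternary_ideal I.

Let idealI : ternary_ideal I. Proof. by case: cidealI. Qed.
Let It1 x y z : I x -> I (tri x y z). Proof. by have [_ /(_ x y z)[]] := idealI. Qed.
Let It3 x y z : I z -> I (tri x y z). Proof. by have [_ /(_ x y z)[]] := idealI. Qed.
Let I0 : I 0. Proof. by have [/submod_closedE[]] := idealI. Qed.
Let ID a x y : I x -> I y -> I (a *: x + y).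
Proof. by have [/submod_closedE[_ H] _] := idealI; exact: H. Qed.

Let Lbar f g : opbar (ell f g) = ell g f. Proof. by []. Qed.
Let Rbar f g : opbar (err f g) = err g f. Proof. by []. Qed.

Let Labs a b f g : I f -> I g -> hatL I (opmul (ell a b) (ell f g)).
Proof. by move=> If Ig; rewrite opmul_ell; apply: genspan_gen => //; exact: It3. Qed.

Let Rabs a b f g : I f -> I g -> hatR I (opmul (err a b) (err f g)).
Proof. by move=> If Ig; rewrite opmul_err; apply: genspan_gen => //; exact: It1. Qed.

Let Lcube f g w : I g -> I w -> hatL I (ell f (tri g g w)).
Proof. by move=> Ig Iw; rewrite ell_tri; apply: genspan_gen => //; exact: It3. Qed.

Let Rcube f g w : I g -> I w -> hatR I (err f (tri g g w)).
Proof. by move=> Ig Iw; rewrite err_tri; apply: genspan_gen => //; exact: It1. Qed.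

Lemma hatA_submod : GRing.submod_closed (mem (hatA I)).
Proof.
have [L0 LD] := (submod_closedE _).1 (@genspan_submod _ _ (@ell R M) I).
have [R0 RD] := (submod_closedE _).1 (@genspan_submod _ _ (@err R M) I).
apply/submod_closedE; split=> // a X Y [X1 X2 X3 X4] [Y1 Y2 Y3 Y4].
by split; [exact: LD|exact: ID|exact: ID|exact: RD].
Qed.

Lemma hatA_self_adjoint : self_adjoint (hatA I).
Proof.
move=> X [X1 X2 X3 X4]; split => //; first exact: (genspan_opbar Lbar X1).
exact: (genspan_opbar Rbar X4).
Qed.

Lemma hatA_closed : closed (hatA I).
Proof.
have clI : closed I by case: cidealI.
have c11 : continuous (fun X : blockmat M => X.1.1).
  by move=> X; apply: continuous_comp; exact: cvg_fst.
have c12 : continuous (fun X : blockmat M => X.1.2).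
  by move=> X; apply: continuous_comp; [exact: cvg_fst|exact: cvg_snd].
have c21 : continuous (fun X : blockmat M => X.2.1).
  by move=> X; apply: continuous_comp; [exact: cvg_snd|exact: cvg_fst].
have c22 : continuous (fun X : blockmat M => X.2.2).
  by move=> X; apply: continuous_comp; exact: cvg_snd.
(* In the (2,1) entry [I] is read in [conj_space M], whose topology is that of M, so it is closed
   there too. *)
have -> : hatA I = ((fun X : blockmat M => X.1.1) @^-1` hatL I `&`
    (fun X : blockmat M => X.1.2) @^-1` I) `&`
    ((fun X : blockmat M => X.2.1) @^-1` (I : set (conj_space M)) `&`
    (fun X : blockmat M => X.2.2) @^-1` hatR I).
  by apply/seteqP; split=> X; [case|case=> -[] ? ? []].
apply: closedI; apply: closedI; apply: closed_comp => [X _|].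
- exact: c11.
- exact: closed_closure.
- exact: c12.
- exact: clI.
- exact: c21.
- exact: clI.
- exact: c22.
- exact: closed_closure.
Qed.

Let Iadd x y : I x -> I y -> I (x + y).
Proof. by move=> Ix; rewrite -(scale1r x); exact: ID. Qed.

Let hatLD A B : hatL I A -> hatL I B -> hatL I (A + B).
Proof.
have [_ LD] := (submod_closedE _).1 (@genspan_submod _ _ (@ell R M) I).
by move=> LA; rewrite -(scale1r A); exact: LD.
Qed.

Let hatRD A B : hatR I A -> hatR I B -> hatR I (A + B).
Proof.
have [_ RD] := (submod_closedE _).1 (@genspan_submod _ _ (@err R M) I).
by move=> RA; rewrite -(scale1r A); exact: RD.
Qed.

Let Lop_ideal A f : Lop A -> I f -> I (A.1 f).
Proof.
have [[smI _] clI] := cidealI; move=> LA If; move: A LA.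
apply: (@closed_span_image _ _ _ (fun A : opair M => A.1 f) id (rnorm f)) => //.
  by move=> A; rewrite mulrC rnorm_opair1.
by move=> _ [g _ [h _ <-]]; exact: It3.
Qed.

Let Rop_ideal A f : Rop A -> I f -> I (A.1 f).
Proof.
have [[smI _] clI] := cidealI; move=> LA If; move: A LA.
apply: (@closed_span_image _ _ _ (fun A : opair M => A.1 f) id (rnorm f)) => //.
  by move=> A; rewrite mulrC rnorm_opair1.
by move=> _ [g _ [h _ <-]]; exact: It1.
Qed.

Let Lop_bar A : Lop A -> Lop (opbar A). Proof. exact: (genspan_opbar Lbar). Qed.
Let Rop_bar A : Rop A -> Rop (opbar A). Proof. exact: (genspan_opbar Rbar). Qed.

Let hatL_bar A : hatL I A -> hatL I (opbar A). Proof. exact: (genspan_opbar Lbar). Qed.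
Let hatR_bar A : hatR I A -> hatR I (opbar A). Proof. exact: (genspan_opbar Rbar). Qed.

Let hatL_ideal A f : hatL I A -> I (A.1 f).
Proof. by move=> LA; apply: (genspan_opair1 cidealI LA) => g h Ig Ih; exact: It1. Qed.

Let hatR_ideal A f : hatR I A -> I (A.1 f).
Proof. by move=> RA; apply: (genspan_opair1 cidealI RA) => g h Ig Ih; exact: It3. Qed.

(** The mixed terms [ell] and [err] in the diagonal entries have only one argument in [I];
    [genspan_genr] is made for them. *)
Lemma hatA_mull X Y : Aemb X -> hatA I Y -> hatA I (mxmul X Y).
Proof.
move=> [X1 X4] [Y1 Y2 Y3 Y4]; split.
- apply: hatLD; first exact: (genspan_opmull Labs X1 Y1).
  exact: (genspan_genr ellBr rnorm_ell cidealI Lcube).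
- by apply: Iadd; [exact: Lop_ideal|exact: hatR_ideal].
(* Second components act in this entry; they are the first components after [opbar]. *)
- apply: Iadd; first exact: (hatL_ideal _ (hatL_bar Y1)).
  exact: (Rop_ideal (Rop_bar X4)).
- apply: hatRD; first exact: (genspan_genr errBr rnorm_err cidealI Rcube).
  (* [opmulr B B'] is [opmul B' B] by definition, so the sides are exchanged in R(M). *)
  exact: (genspan_opmulr Rbar Rabs X4 Y4).
Qed.

Lemma hatA_mulr X Y : Aemb X -> hatA I Y -> hatA I (mxmul Y X).
Proof.
move=> [X1 X4] [Y1 Y2 Y3 Y4]; split.
- apply: hatLD; first exact: (genspan_opmulr Lbar Labs X1 Y1).
  exact: (genspan_genl Lbar ellBr rnorm_ell cidealI Lcube).
- by apply: Iadd; [exact: hatL_ideal|exact: Rop_ideal].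
- apply: Iadd; first exact: (Lop_ideal (Lop_bar X1)).
  exact: (hatR_ideal _ (hatR_bar Y4)).
- apply: hatRD; first exact: (genspan_genl Rbar errBr rnorm_err cidealI Rcube).
  exact: (genspan_opmull Rabs X4 Y4).
Qed.

Lemma hatA_sub_Aemb : hatA I `<=` @Aemb R M.
Proof.
move=> X [X1 _ _ X4]; split; first exact: (genspan_monotone X1).
exact: (genspan_monotone X4).
Qed.

(** The (1,2) corner recovers [I] from [hatA I], which gives injectivity. *)
Lemma hatA_offdiag f : hatA I (mkmat 0 f 0 0) <-> I f.
Proof.
have [L0 _] := (submod_closedE _).1 (@genspan_submod _ _ (@ell R M) I).
have [R0 _] := (submod_closedE _).1 (@genspan_submod _ _ (@err R M) I).
by split=> [[]|If].
Qed.

End BlockIdeal.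

Theorem proposition4p2 (R : realType) (M : cstarTernaryRingType R) :
  (forall I : set M, closed_ternary_ideal I -> closed_self_adjoint_ideal (hatA I)) /\
  set_inj [set I : set M | closed_ternary_ideal I] (@hatA R M).
Proof.
split=> [I cI|I J].
  split; [split|exact: hatA_closed|exact: hatA_self_adjoint].
  - exact: hatA_sub_Aemb.
  - exact: hatA_submod.
  - by move=> X Y AX IY; split; [exact: hatA_mull|exact: hatA_mulr].
rewrite !inE => cI cJ IJ; apply/seteqP.
split=> f.
  by move=> /(hatA_offdiag cI); rewrite IJ => /(hatA_offdiag cJ).
by move=> /(hatA_offdiag cJ); rewrite -IJ => /(hatA_offdiag cI).
Qed.
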